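(* For $\varepsilon>0$ and $0<\tau\le\varepsilon$, with $\lambda=\tau/\varepsilon$, let $H=H_{\varepsilon,\tau}:\mathcal V_{[0,1]}\to\mathbb R$ be $$H(u)=\lambda\langle u,\mathbf 1-u\rangle_{\mathcal V}+\langle u,(I-e^{-\tau\Delta})u\rangle_{\mathcal V}.$$ Then $\frac1{2\tau}H$ $\Gamma$-converges in $\mathcal V_{[0,1]}$ to $f_0$ as $\varepsilon\downarrow0$ with $0<\tau\le\varepsilon$, i.e. $$\Gamma\text{-}\lim_{\varepsilon\downarrow0,\ 0<\tau\le\varepsilon}\frac1{2\tau}H=f_0 ,$$ meaning that $\frac{1}{2\tau_j}H_{\varepsilon_j,\tau_j}$ $\Gamma$-converges to $f_0$ for all sequences $\varepsilon_j\downarrow0$ and $0<\tau_j\le\varepsilon_j$.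
   Context: Let $G=(V,E)$ be a finite, undirected, simple, connected graph with symmetric weights $\omega_{ij}=\omega_{ji}$, $\omega_{ij}>0$ for $ij\in E$ and $\omega_{ij}=0$ for $ij\notin E$. Let $d_i=\sum_{j}\omega_{ij}>0$ be the degree of $i\in V$. Fix $r\in[0,1]$. Let $\mathcal V=\{u:V\to\mathbb R\}$ and, for $X\subseteq\mathbb R$, $\mathcal V_X=\{u:V\to X\}$; $\mathcal V$ carries the inner product $\langle u,v\rangle_{\mathcal V}=\sum_{i\in V}u_iv_id_i^r$ with norm $\|\cdot\|_{\mathcal V}$, and $\mathcal V_{[0,1]}$ has the induced topology. $\mathbf 1\in\mathcal V$ is the constant function $1$. The graph Laplacian is $(\Delta u)_i=d_i^{-r}\sum_{j\in V}\omega_{ij}(u_i-u_j)$, and $e^{-t\Delta}=\sum_{n\ge0}\frac{(-1)^nt^n}{n!}\Delta^n$. Graph total variation is $\mathrm{TV}(u)=\frac12\sum_{i,j\in V}\omega_{ij}|u_i-u_j|$. The function $f_0:\mathcal V_{[0,1]}\to[0,\infty]$ is $f_0(u)=\frac12\mathrm{TV}(u)$ if $u\in\mathcal V_{\{0,1\}}$ and $f_0(u)=\infty$ if $u\in\mathcal V_{[0,1]}\setminus\mathcal V_{\{0,1\}}$. $\Gamma$-convergence of $F_j$ to $F$ on $\mathcal V_{[0,1]}$ means: for every $u\in\mathcal V_{[0,1]}$, (i) $F(u)\le\liminf_jF_j(u_j)$ for every sequence $u_j\to u$ in $\mathcal V_{[0,1]}$, and (ii) there is a sequence $\bar u_j\to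 u$ in $\mathcal V_{[0,1]}$ with $F(u)=\lim_jF_j(\bar u_j)$. *)

(* Defs.v *)
From mathcomp Require Import all_boot all_order all_algebra.
From mathcomp Require Import all_classical all_reals all_analysis.
Import Order.TTheory GRing.Theory Num.Theory numFieldNormedType.Exports.

Set Implicit Arguments.
Unset Strict Implicit.
Unset Printing Implicit Defensive.

Local Open Scope classical_set_scope.
Local Open Scope ring_scope.

Section VertexFunctions.
Context {R : realType} {V : finType}.

Definition VX (X : set R) : set (V -> R) := [set u | range u `<=` X].

Definition weighted_degree (w : V -> V -> R) (i : V) : R := \sum_(j : V) w i j.

End VertexFunctions.

(* Positivity of the degrees is not implied by connectedness: it excludes the
   graph with a single vertex. *)
Record weighted_graph (R : realType) (V : finType) := WeightedGraph {
  edge : rel V;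
  weight : V -> V -> R;
  edge_sym : symmetric edge;
  edge_irr : irreflexive edge;
  edge_connected : forall i j : V, connect edge i j;
  weight_sym : forall i j : V, weight i j = weight j i;
  weight_gt0 : forall i j : V, edge i j -> 0 < weight i j;
  weight_eq0 : forall i j : V, ~~ edge i j -> weight i j = 0;
  degree_gt0 : forall i : V, 0 < weighted_degree weight i
}.

Section GraphCalculus.
Context {R : realType} {V : finType} (G : weighted_graph R V) (r : R).

Definition degree (i : V) : R := weighted_degree (weight G) i.

Definition inner (u v : V -> R) : R :=
  \sum_(i : V) u i * v i * degree i `^ r.

Definition normV (u : V -> R) : R := Num.sqrt (inner u u).

Definition cvgV (u_ : nat -> V -> R) (u : V -> R) : Prop :=
  normV (u_ j \- u) @[j --> \oo] --> (0 : R).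

Definition laplacian (u : V -> R) : V -> R := fun i =>
  degree i `^ (- r) * \sum_(j : V) weight G i j * (u i - u j).

Definition exp_laplacian_coeff (t : R) (u : V -> R) (i : V) : R^nat := fun n =>
  (-1) ^+ n * t ^+ n / n`!%:R * iter n laplacian u i.

(* exp (- t Delta) u; since V is finite, the exponential series is summed
   vertex by vertex (it converges: see cvg_exp_laplacian below). *)
Definition exp_laplacian (t : R) (u : V -> R) : V -> R := fun i =>
  limn (series (exp_laplacian_coeff t u i)).

Definition TV (u : V -> R) : R :=
  2^-1 * \sum_(i : V) \sum_(j : V) weight G i j * `|u i - u j|.

Definition f0 (u : V -> R) : \bar R :=
  if u \in VX [set 0; 1] then (2^-1 * TV u)%:E else +oo%E.

Definition H (eps tau : R) (u : V -> R) : R :=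
  (tau / eps) * inner u (cst 1 \- u) + inner u (u \- exp_laplacian tau u).

(* Gamma-convergence on a subset A of the functions on V, for the topology
   induced on A by normV; functionals on A are total functions of which only
   the values on A matter. *)
Definition gamma_cvg (A : set (V -> R)) (F_ : nat -> (V -> R) -> \bar R)
    (F : (V -> R) -> \bar R) : Prop :=
  forall u : V -> R, A u ->
    (forall u_ : nat -> V -> R, (forall j, A (u_ j)) -> cvgV u_ u ->
       (F u <= limn_einf (fun j => F_ j (u_ j)))%E) /\
    (exists u_ : nat -> V -> R, [/\ (forall j, A (u_ j)), cvgV u_ u &
       F_ j (u_ j) @[j --> \oo] --> F u]).

Lemma laplacian_bound : exists2 K : R, 0 <= K &
  forall (u : V -> R) (B : R), (forall i, `|u i| <= B) ->
    forall i, `|laplacian u i| <= K * B.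
Proof.
pose k i : R := degree i `^ (- r) * \sum_(j : V) `|weight G i j| * 2.
have k0 i : 0 <= k i.
  by rewrite mulr_ge0 ?powR_ge0// sumr_ge0// => j _; rewrite mulr_ge0.
exists (\sum_i k i) => [|u B uB i]; first by rewrite sumr_ge0.
have B0 : 0 <= B by rewrite (le_trans _ (uB i)).
apply: (@le_trans _ _ (k i * B)); last first.
  by rewrite ler_wpM2r// (bigD1 i)//= lerDl sumr_ge0.
rewrite /laplacian normrM ger0_norm ?powR_ge0// -mulrA ler_wpM2l ?powR_ge0//.
rewrite (le_trans (ler_norm_sum _ _ _))// mulr_suml ler_sum// => j _.
rewrite normrM -mulrA ler_wpM2l// mulr_natl mulr2n.
by rewrite (le_trans (ler_normB _ _))// lerD.
Qed.

Lemma cvg_exp_laplacian (t : R) (u : V -> R) (i : V) :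
  series (exp_laplacian_coeff t u i) @ \oo --> exp_laplacian t u i.
Proof.
have [K K0 lapK] := laplacian_bound.
pose B : R := \sum_i `|u i|.
have itB n j : `|iter n laplacian u j| <= K ^+ n * B.
  elim: n j => [|n IH] j /=; last by rewrite exprS -mulrA lapK.
  by rewrite expr0 mul1r /B (bigD1 j)//= lerDl sumr_ge0.
suff : cvgn (series (exp_laplacian_coeff t u i)) by [].
apply: normed_cvg.
apply: (@series_le_cvg _ _ (B *: exp_coeff (`|t| * K))) => [n|n|n|].
- exact: normr_ge0.
- rewrite /= /exp_coeff /= mulr_ge0 ?sumr_ge0// mulr_ge0 ?invr_ge0//.
  by rewrite exprn_ge0// mulr_ge0.
- rewrite /exp_laplacian_coeff /exp_coeff /= !normrM normrX normrN1 expr1n mul1r.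
  rewrite normrX normfV normr_nat.
  have -> : (B *: exp_coeff (`|t| * K)) n = `|t| ^+ n / n`!%:R * (K ^+ n * B).
    rewrite -[LHS]/(B * ((`|t| * K) ^+ n / n`!%:R)) exprMn.
    by rewrite mulrC mulrACA -!mulrA; do 2 congr (_ * _); rewrite mulrCA.
  by rewrite ler_wpM2l// mulr_ge0// exprn_ge0.
- apply: is_cvg_seriesZ; exact: is_cvg_series_exp_coeff.
Qed.

End GraphCalculus.

(* Main.v *)
Require Import Defs.
From mathcomp Require Import all_boot all_order all_algebra.
From mathcomp Require Import all_classical all_reals all_analysis.
From mathcomp Require Import ring lra.
Import Order.TTheory GRing.Theory Num.Theory numFieldNormedType.Exports.
Local Open Scope classical_set_scope.
Local Open Scope ring_scope.

(** Dividing by [2 tau] splits the functional into two terms ([scaled_H]),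
[[
  H u / (2 tau) = <u, 1 - u> / (2 eps) + <u, (I - exp (- tau Delta)) u> / (2 tau).
]]
The second term has a limit along every convergent sequence with values in
the unit interval: on bounded sets, [exp (- tau Delta) u = u - tau Delta u + O(tau^2)]
uniformly in [u] ([exp_laplacian_taylor1]), so that this term converges to
[<u, Delta u> / 2] as [u_j --> u] and [tau_j --> 0] ([cvg_inner_heat]).
Summation by parts turns [<u, Delta u>] into the Dirichlet energy
[(1/2) sum_ij w_ij (u_i - u_j)^2], and this is [TV u] when [u] is binary, since
a difference [d] in [{-1, 0, 1}] satisfies [d^2 = |d|]
([inner_laplacian_binary]).

The first term is a double-well penalty: it is nonnegative on functions with
values in the unit interval, vanishes exactly at the binary ones, and is multiplied by
[1 / (2 eps)], which tends to infinity.  If the limit [u] is binary, dropping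
the penalty gives the liminf inequality, and nothing is lost along the constant
sequence [u].  If [u] is not binary, the penalty at [u_j] stays above a positive
constant times [1 / eps_j] while the other term is bounded, so the functionals
diverge to infinity along every sequence that converges to [u], and both
requirements hold with [f0 u] infinite. *)

(** * Limits of sequences *)

(** This reduces the liminf inequality to the convergence of a minorant, without
    any information on the convergence of [b]. *)
Lemma le_limn_einf {R : realType} (a b : nat -> \bar R) (l : \bar R) :
  (forall j, (a j <= b j)%E) -> a @ \oo --> l -> (l <= limn_einf b)%E.
Proof.
move=> ab al; have [<- _] := cvg_limn_einf_sup al; rewrite !limn_einf_lim.
apply: lee_lim; [exact: is_cvg_einfs|exact: is_cvg_einfs|].
apply: nearW => n; apply: le_ereal_inf_tmp => _ [k /= nk <-].
by apply: ge_ereal_inf; exists (a k) => //; exists k.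
Qed.

Lemma cvg_dist_le {R : realType} (f h : nat -> R) (l : R) :
  (\forall j \near \oo, `|f j - l| <= h j) -> h @ \oo --> (0 : R) ->
  f @ \oo --> l.
Proof.
move=> fh h0; apply/cvgrPdistC_le => e e0; near=> j.
apply: (@le_trans _ _ (h j)); first by near: j.
by near: j; exact: (cvgr_le _ h0).
Unshelve. all: by end_near. Qed.

Lemma cvg_fin_sum {R : realType} {V : finType} (F : V -> nat -> R) (l : V -> R) :
  (forall i, F i j @[j --> \oo] --> l i) ->
  \sum_i F i j @[j --> \oo] --> \sum_i l i.
Proof. by move=> Fl; apply: cvg_big => [|i _]; [exact: add_continuous|exact: Fl]. Qed.

(** * Convergence in the weighted norm *)

Section GraphFunctions.
Context {R : realType} {V : finType} (G : weighted_graph R V) (r : R).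
Implicit Types (u v : V -> R) (i : V).

Lemma degree_powR_gt0 i : 0 < degree G i `^ r.
Proof. by rewrite powR_gt0// degree_gt0. Qed.

(** A single term of the weighted sum of squares bounds the coordinate:
    [|u_j i - u i| * sqrt (d_i ^ r)] is at most the norm of [u_j - u]. *)
Lemma cvgV_pointwise {u_ : nat -> V -> R} {u} i :
  Defs.cvgV G r u_ u -> u_ j i @[j --> \oo] --> u i.
Proof.
move=> uu; pose s := Num.sqrt (degree G i `^ r).
have s0 : 0 < s by rewrite sqrtr_gt0 degree_powR_gt0.
apply: (@cvg_dist_le _ _ (fun j => s^-1 * normV G r (u_ j \- u))).
  apply: nearW => j; rewrite mulrC ler_pdivlMr//.
  rewrite -sqrtr_sqr -sqrtrM ?sqr_ge0// ler_wsqrtr// /inner.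
  rewrite (bigD1 i)//= expr2 lerDl sumr_ge0// => k _.
  by rewrite mulr_ge0 ?powR_ge0// -expr2 sqr_ge0.
by rewrite -[X in _ --> X](mulr0 s^-1); exact: cvgMl_tmp.
Qed.

Lemma cvgV_cst u : Defs.cvgV G r (fun=> u) u.
Proof.
rewrite /Defs.cvgV (_ : normV _ _ _ = 0); first exact: cvg_cst.
rewrite /normV /inner big1 ?sqrtr0// => i _.
by rewrite /= subrr !mul0r.
Qed.

Lemma cvg_inner (u_ v_ : nat -> V -> R) u v :
  (forall i, u_ j i @[j --> \oo] --> u i) ->
  (forall i, v_ j i @[j --> \oo] --> v i) ->
  inner G r (u_ j) (v_ j) @[j --> \oo] --> inner G r u v.
Proof.
move=> uu vv; apply: cvg_fin_sum => i.
by apply: cvgM; [exact: cvgM|exact: cvg_cst].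
Qed.

Lemma cvg_laplacian (u_ : nat -> V -> R) u i :
  (forall i, u_ j i @[j --> \oo] --> u i) ->
  laplacian G r (u_ j) i @[j --> \oo] --> laplacian G r u i.
Proof.
move=> uu; apply: cvgM; first exact: cvg_cst.
apply: cvg_fin_sum => k; apply: cvgM; first exact: cvg_cst.
exact: cvgB.
Qed.

(** * The Dirichlet energy *)

(** The factor [d_i ^ (- r)] of the Laplacian cancels the weight [d_i ^ r] of the
    inner product; exchanging the summation indices and averaging then
    completes the square. *)
Lemma inner_laplacian u : inner G r u (laplacian G r u) =
  2^-1 * \sum_i \sum_j weight G i j * (u i - u j) ^+ 2.
Proof.
have -> : inner G r u (laplacian G r u) =
    \sum_i \sum_j weight G i j * (u i * (u i - u j)).
  apply: eq_bigr => i _.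
  have : degree G i `^ r * degree G i `^ (- r) = 1.
    by rewrite powRN divff// gt_eqF// degree_powR_gt0.
  rewrite /laplacian; set p := _ `^ r; set q := _ `^ - r => pq.
  rewrite -mulrA [_ * p]mulrC [p * _]mulrA pq mul1r mulr_sumr.
  by apply: eq_bigr => j _; rewrite mulrCA.
set S := LHS; have S' : S = \sum_i \sum_j weight G i j * (u j * (u j - u i)).
  rewrite exchange_big; apply: eq_bigr => i _; apply: eq_bigr => j _.
  by rewrite weight_sym.
(* u_i (u_i - u_j) + u_j (u_j - u_i) = (u_i - u_j)^2 *)
have -> : S = 2^-1 * (S + S) by field.
rewrite {2}S' /S -big_split; congr (_ * _); apply: eq_bigr => i _.
by rewrite -big_split; apply: eq_bigr => j _ /=; ring.
Qed.

Lemma inner_laplacian_binary u : VX [set 0; 1] u ->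
  inner G r u (laplacian G r u) = TV G u.
Proof.
move=> u01; rewrite inner_laplacian; congr (_ * _).
apply: eq_bigr => i _; apply: eq_bigr => j _; congr (_ * _).
have [-> | ->] : u i = 0 \/ u i = 1 by apply: u01; exists i.
  have [-> | ->] : u j = 0 \/ u j = 1 by apply: u01; exists j.
    by rewrite subrr expr0n normr0.
  by rewrite sub0r sqrrN expr1n normrN1.
have [-> | ->] : u j = 0 \/ u j = 1 by apply: u01; exists j.
  by rewrite subr0 expr1n normr1.
by rewrite subrr expr0n normr0.
Qed.

(** * The heat semigroup at small times *)

(** If [K] bounds the Laplacian in the sup norm, the terms of order [n >= 2] of
    the exponential series are at most [t^n K^n B / n! <= t^2 K^n B / n!] for
    [t <= 1], hence their sum is at most [t^2 B exp K].  The constant does not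
    depend on [u], which is what allows [u] to move with [t] below. *)
Lemma exp_laplacian_taylor1 : exists C : R,
  forall (t : R) u (B : R), 0 <= t <= 1 -> (forall i, `|u i| <= B) ->
  forall i, `|exp_laplacian G r t u i - (u i - t * laplacian G r u i)|
            <= C * B * t ^+ 2.
Proof.
have [K K0 lapK] := laplacian_bound G r.
exists (expR K) => t u B /andP[t0 t1] uB i.
have B0 : 0 <= B by rewrite (le_trans _ (uB i)).
have itB n j : `|iter n (laplacian G r) u j| <= K ^+ n * B.
  elim: n j => [|n IH] j /=; first by rewrite expr0 mul1r.
  by rewrite exprS -mulrA lapK.
set a := exp_laplacian_coeff G r t u i.
have a2 : series a 2 = u i - t * laplacian G r u i.
  rewrite /series/= big_nat_recr//= big_nat1 /a /exp_laplacian_coeff /=.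
  by rewrite !fact0 expr0 !expr1 !divr1; ring.
have cva : `|series a n - series a 2| @[n --> \oo] -->
    `|exp_laplacian G r t u i - (u i - t * laplacian G r u i)|.
  apply: cvg_norm; rewrite -a2; apply: cvgB; last exact: cvg_cst.
  exact: cvg_exp_laplacian.
apply: (cvgr_to_le cva); exists 2 => //= n n2.
rewrite sub_series_geq//.
have exp_le : series (exp_coeff K) n <= expR K.
  apply: nondecreasing_cvgn_le; last exact: is_cvg_series_exp_coeff.
  by apply: nondecreasing_series => k _ _; exact: exp_coeff_ge0.
apply: (@le_trans _ _ (series (exp_coeff K) n * (B * t ^+ 2))); last first.
  by rewrite -mulrA ler_wpM2r// mulr_ge0// exprn_ge0.
(* The first two terms of the majorant series are nonnegative and are dropped. *)
rewrite mulr_suml (le_trans (ler_norm_sum _ _ _))//.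
rewrite [leRHS](@big_cat_nat _ _ _ 2)//= -[leLHS]add0r lerD//.
  apply: sumr_ge0 => k _.
  by rewrite mulr_ge0 ?exp_coeff_ge0// mulr_ge0// exprn_ge0.
rewrite !big_nat; apply: ler_sum => k /andP[k2 _].
rewrite /a /exp_laplacian_coeff /exp_coeff /= !normrM !normrX normrN1 expr1n.
rewrite mul1r normfV normr_nat (ger0_norm t0).
have -> : K ^+ k / k`!%:R * (B * t ^+ 2) = t ^+ 2 / k`!%:R * (K ^+ k * B) by ring.
apply: ler_pM => //; first by rewrite divr_ge0// exprn_ge0.
by rewrite ler_wpM2r// ler_wiXn2l.
Qed.

(** The difference quotient [(u_j - exp (- t_j Delta) u_j) / t_j] is within
    [C B t_j] of [Delta u_j] at every vertex, and [Delta] is continuous. *)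
Lemma cvg_inner_heat (u_ : nat -> V -> R) u (t : nat -> R) (B : R) :
  (forall j, 0 < t j) -> t @ \oo --> (0 : R) ->
  (forall j i, `|u_ j i| <= B) ->
  (forall i, u_ j i @[j --> \oo] --> u i) ->
  (t j)^-1 * inner G r (u_ j) (u_ j \- exp_laplacian G r (t j) (u_ j))
    @[j --> \oo] --> inner G r u (laplacian G r u).
Proof.
move=> t_gt0 t_cvg0 uB uu.
have -> : (fun j => (t j)^-1 *
      inner G r (u_ j) (u_ j \- exp_laplacian G r (t j) (u_ j))) =
    (fun j => inner G r (u_ j)
      (fun i => (t j)^-1 * (u_ j i - exp_laplacian G r (t j) (u_ j) i))).
  apply/funext => j; rewrite /inner mulr_sumr; apply: eq_bigr => i _ /=.
  ring.
apply: cvg_inner => // i.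
have [C taylor] := exp_laplacian_taylor1.
rewrite -[X in _ --> X]add0r.
have -> : (fun j => (t j)^-1 * (u_ j i - exp_laplacian G r (t j) (u_ j) i)) =
    (fun j => ((t j)^-1 * (u_ j i - exp_laplacian G r (t j) (u_ j) i)
               - laplacian G r (u_ j) i) + laplacian G r (u_ j) i).
  by apply/funext => j; rewrite subrK.
apply: cvgD; last exact: cvg_laplacian.
apply: (@cvg_dist_le _ _ (fun j => C * B * t j)); last first.
  by rewrite -[X in _ --> X](mulr0 (C * B)); exact: cvgMl_tmp.
have : \forall j \near \oo, t j <= 1 by exact: (cvgr_le _ t_cvg0).
apply: filterS => j tj1; rewrite subr0.
have tj0 := t_gt0 j.
have t01 : 0 <= t j <= 1 by rewrite ltW.
have bd := taylor (t j) (u_ j) B t01 (uB j) i.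
rewrite -(ler_pM2r tj0) -[X in _ * X <= _](gtr0_norm tj0) -normrM -[leRHS]mulrA -expr2.
rewrite -normrN.
suff -> : - (((t j)^-1 * (u_ j i - exp_laplacian G r (t j) (u_ j) i)
    - laplacian G r (u_ j) i) * t j) = exp_laplacian G r (t j) (u_ j) i
    - (u_ j i - t j * laplacian G r (u_ j) i) by [].
by field; rewrite gt_eqF.
Qed.

(** * The double-well penalty *)

Lemma VX01P u : VX `[0, 1] u <-> forall i, 0 <= u i <= 1.
Proof.
split=> [u01 i|u01 _ [i _ <-]]; last by rewrite /= in_itv/= u01.
by have := u01 (u i); rewrite /= in_itv/=; apply; exists i.
Qed.

Lemma double_well_ge0 u : VX `[0, 1] u -> 0 <= inner G r u (cst 1 \- u).
Proof.
move=> /VX01P u01; apply: sumr_ge0 => i _; rewrite mulr_ge0 ?powR_ge0//.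
by have /andP[? ?] := u01 i; rewrite mulr_ge0//= subr_ge0.
Qed.

Lemma double_well_binary u : VX [set 0; 1] u -> inner G r u (cst 1 \- u) = 0.
Proof.
move=> u01; apply: big1 => i _ /=.
have [-> | ->] : u i = 0 \/ u i = 1 by apply: u01; exists i.
  by rewrite !mul0r.
by rewrite subrr mulr0 mul0r.
Qed.

(** A vanishing sum of nonnegative terms [u_i (1 - u_i) d_i ^ r] forces each
    [u_i] to be [0] or [1], the weights being positive. *)
Lemma double_well_gt0 u : VX `[0, 1] u -> ~ VX [set 0; 1] u ->
  0 < inner G r u (cst 1 \- u).
Proof.
move=> u01 nu; rewrite lt_neqAle double_well_ge0// andbT eq_sym.
apply: contra_notN nu => /eqP u0 _ [i _ <-].
move: u0 => /psumr_eq0P; have /VX01P u01' := u01.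
move=> /(_ _ i isT) /= /(_ _)/eqP; rewrite !mulf_eq0 subr_eq0.
rewrite (gt_eqF (degree_powR_gt0 i)) orbF => /(_ _)/orP[k _||].
- by rewrite !mulr_ge0 ?powR_ge0//= ?subr_ge0//; have /andP[] := u01' k.
- by move=> /eqP ->; left.
- by move=> /eqP <-; right.
Qed.

(** * Gamma-convergence *)

Lemma scaled_H e t u : 0 < e -> 0 < t ->
  (2 * t)^-1 * H G r e t u = e^-1 * (2^-1 * inner G r u (cst 1 \- u)) +
    2^-1 * (t^-1 * inner G r u (u \- exp_laplacian G r t u)).
Proof.
by move=> e0 t0; rewrite /H; field; rewrite !gt_eqF.
Qed.

End GraphFunctions.

Theorem corollary6p2 (R : realType) (V : finType) (G : weighted_graph R V)
    (r : R) (hr : 0 <= r <= 1) (eps tau : nat -> R)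
    (heps_gt0 : forall j : nat, 0 < eps j)
    (heps_cvg : eps j @[j --> \oo] --> (0 : R))
    (htau : forall j : nat, 0 < tau j <= eps j) :
  gamma_cvg G r (VX `[0, 1])
    (fun (j : nat) (u : V -> R) => ((2 * tau j)^-1 * H G r (eps j) (tau j) u)%:E)
    (f0 G).
Proof.
have tau_gt0 j : 0 < tau j by case/andP: (htau j).
have tau_cvg : tau @ \oo --> (0 : R).
  apply: cvg_dist_le heps_cvg; apply: nearW => j.
  by rewrite subr0 gtr0_norm//; case/andP: (htau j).
move=> u u01.
pose heat j v := 2^-1 * ((tau j)^-1 *
  inner G r v (v \- exp_laplacian G r (tau j) v)).
have heat_cvg u_ : (forall j, VX `[0, 1] (u_ j)) -> Defs.cvgV G r u_ u ->
    heat j (u_ j) @[j --> \oo] --> 2^-1 * inner G r u (laplacian G r u).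
  move=> u_01 uu; apply: cvgMl_tmp; apply: (@cvg_inner_heat _ _ _ _ _ _ _ 1) => //.
    by move=> j i; have /VX01P/(_ i)/andP[? ?] := u_01 j; rewrite ger0_norm.
  by move=> i; exact: cvgV_pointwise uu.
rewrite /f0; case: ifPn => [/set_mem u_bin | /negP u_nbin].
  rewrite -(inner_laplacian_binary G r _ u_bin).
  split=> [u_ u_01 uu|].
    apply: (@le_limn_einf _ (fun j => (heat j (u_ j))%:E)) => [j|].
      rewrite lee_fin scaled_H// lerDr mulrA.
      by rewrite mulr_ge0 ?double_well_ge0// mulr_ge0 ?invr_ge0// ltW.
    by apply: cvg_EFin; [exact: nearW|exact: heat_cvg].
  exists (fun=> u); split=> //; first exact: cvgV_cst.
  have -> : (fun j => ((2 * tau j)^-1 * H G r (eps j) (tau j) u)%:E) =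
      (fun j => (heat j u)%:E).
    by apply/funext => j; rewrite scaled_H// double_well_binary// !mulr0 add0r.
  by apply: cvg_EFin; [exact: nearW|apply: heat_cvg => //; exact: cvgV_cst].
(* In the second case f0 u is infinite: both conditions follow from divergence. *)
have blowup u_ : (forall j, VX `[0, 1] (u_ j)) -> Defs.cvgV G r u_ u ->
    ((2 * tau j)^-1 * H G r (eps j) (tau j) (u_ j))%:E @[j --> \oo] --> +oo%E.
  move=> u_01 uu; apply/cvgeryP.
  have W0 : 0 < inner G r u (cst 1 \- u).
    by apply: double_well_gt0 => // /mem_set.
  set W := inner G r u (cst 1 \- u) in W0.
  have W_cvg : inner G r (u_ j) (cst 1 \- u_ j) @[j --> \oo] --> W.
    apply: cvg_inner => i; first exact: cvgV_pointwise uu.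
    by apply: cvgB; [exact: cvg_cst|exact: cvgV_pointwise uu].
  set D := 2^-1 * inner G r u (laplacian G r u).
  have eps_oo : (eps j)^-1 @[j --> \oo] --> +oo.
    apply/gtr0_cvgV0; first by apply: nearW => j; rewrite invr_gt0.
    by under eq_cvg do rewrite /= invrK.
  have W4 : 0 < W / 4 by rewrite divr_gt0.
  have WW : W / 2 < W by rewrite ltr_pdivrMr// ltr_pMr// ltr1n.
  have DD : D - 1 < D by rewrite ltrBlDr ltrDl.
  (* With penalty at least W / 2 and heat term at least D - 1, the sum exceeds A
     once 1 / eps_j exceeds (A - (D - 1)) / (W / 4). *)
  apply/cvgryPge => A; near=> j.
  have eA : (A - (D - 1)) / (W / 4) <= (eps j)^-1.
    by near: j; exact: (cvgry_ge eps_oo).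
  have jW : W / 2 <= inner G r (u_ j) (cst 1 \- u_ j).
    by near: j; exact: (cvgr_ge _ W_cvg).
  have jD : D - 1 <= heat j (u_ j).
    by near: j; exact: (cvgr_ge _ (heat_cvg _ u_01 uu)).
  rewrite scaled_H// -[A](subrK (D - 1)) lerD//.
  rewrite ler_pdivrMr// in eA; apply: (le_trans eA).
  by rewrite ler_wpM2l ?invr_ge0 ?(ltW (heps_gt0 j))//; lra.
split=> [u_ u_01 uu|]; first by have [-> _] := cvg_limn_einf_sup (blowup _ u_01 uu).
exists (fun=> u); split=> //; first exact: cvgV_cst.
by apply: blowup => //; exact: cvgV_cst.
Unshelve. all: by end_near. Qed.
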